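(* Let $(\epsilon_k)_{k\ge1}$ be any sequence of positive real numbers tending to zero. The following are equivalent: (a) there is a finite constant $C$ such that $\displaystyle\sup_{\ell\in\mathbb{Z}}\sum_{k=1}^\infty\left|\widehat\varphi_{\epsilon_{k+1}}(\ell)-\widehat\varphi_{\epsilon_k}(\ell)\right|\le C$; (b) there is a finite constant $K$ such that $\displaystyle\sup_{t\in\mathbb{R}}\sum_{k=1}^\infty\left|\widehat{\varphi^R_{\epsilon_{k+1}}}(t)-\widehat{\varphi^R_{\epsilon_k}}(t)\right|\le K$.
   Context: For $\epsilon>0$: $\widehat\varphi_\epsilon(\ell)=\frac{\sin(\ell\epsilon)}{\ell\epsilon}$ for $\ell\in\mathbb{Z}$, and $\widehat{\varphi^R_\epsilon}(t)=\frac{\sin(\epsilon t)}{\epsilon t}$ for $t\in\mathbb{R}$ (both equal to $1$ at $0$). These are the Fourier transforms of the normalized indicator functions $\frac1{2\epsilon}1_{[-\epsilon,\epsilon]}$ on the circle and on the real line respectively. *)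

(* Defs.v *)
From HB Require Import structures.
From mathcomp Require Import all_boot all_order all_algebra.
From mathcomp Require Import all_classical all_reals all_analysis.

Set Implicit Arguments.
Unset Strict Implicit.
Unset Printing Implicit Defensive.

Import Order.TTheory GRing.Theory Num.Theory.
Import numFieldNormedType.Exports.

Local Open Scope ring_scope.

(* Fourier coefficients of (2 eps)^-1 1_[-eps, eps] on the circle R / 2 pi Z. *)
Definition phihat_circle (R : realType) (eps : R) (l : int) : R :=
  if l == 0 then 1 else sin (l%:~R * eps) / (l%:~R * eps).

(* Fourier transform of (2 eps)^-1 1_[-eps, eps] on the real line. *)
Definition phihat_line (R : realType) (eps t : R) : R :=
  if t == 0 then 1 else sin (eps * t) / (eps * t).

(* Main.v *)
Require Import Defs.
From HB Require Import structures.
From mathcomp Require Import all_boot all_order all_algebra.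
From mathcomp Require Import all_classical all_reals all_analysis.
From mathcomp Require Import ring lra zify.

(** Both multipliers are values of sinc x = sin x / x: at scale eps and
frequency t they equal sinc (t * eps), so the circle only sees the integer
values of t and the bound on the line restricts to a bound on the circle.

For the converse, write t = l + s with l a natural number and 0 <= s < 1
(sinc is even).  The identity
  sin ((l + s) x) sin x = sin (l x) sin ((1 - s) x) + sin ((l + 1) x) sin (s x)
becomes, after division by x ^ 2,
  (l + s) sinc ((l + s) x) sinc x
    = l (1 - s) sinc (l x) sinc ((1 - s) x)
      + (l + 1) s sinc ((l + 1) x) sinc (s x)    ([sinc_interpolation]).
The two weights on the right add up to l + s, so sinc (t x) sinc x is a convex
combination of the integer-frequency values sinc (l x) and sinc ((l + 1) x),
corrected by the factors sinc ((1 - s) x) and sinc (s x) of frequency at most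
one.  On ]0, 1] these factors are harmless: sinc is bounded below by 1/2, and
for 0 < y <= x <= 1 the decrease sinc y - sinc x is comparable to
x ^ 2 - y ^ 2 ([sincB_bounds]), so an increment of sinc (u * _) with
0 <= u <= 1 is at most twice the same increment of sinc, which is the
increment at the integer frequency one ([normr_sincMB_le]).

Hence, as soon as two consecutive scales are at most 1, the increment at
frequency t is controlled by those at the frequencies l, l + 1 and 1
([normr_sinc_step]).  Since the scales tend to zero, only finitely many steps
escape this estimate, and each of them contributes at most 2. *)

Set Implicit Arguments.
Unset Strict Implicit.
Unset Printing Implicit Defensive.

Import Order.TTheory GRing.Theory Num.Theory.
Import numFieldNormedType.Exports.

Local Open Scope classical_set_scope.
Local Open Scope ring_scope.

(** * Trigonometric inequalities near zero *)

Lemma ge0_is_derive_le (R : realType) (f df : R -> R) (a b : R) :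
  a <= b ->
  (forall z, a <= z <= b -> is_derive z 1 f (df z)) ->
  (forall z, a <= z <= b -> 0 <= df z) -> f a <= f b.
Proof.
move=> ab fdf df0.
have [z zab| |c] := @MVT_segment R f df a b ab.
- by apply: fdf; move: zab; rewrite in_itv /= => /andP[/ltW-> /ltW->].
- apply: derivable_within_continuous => z; rewrite in_itv /= => zab.
  by have [] := fdf _ zab.
- rewrite in_itv /= => cab fE.
  by rewrite -subr_ge0 fE mulr_ge0 ?df0 ?subr_ge0.
Qed.

Lemma sin_le_id (R : realType) (x : R) : 0 <= x -> sin x <= x.
Proof.
move=> x0; pose f (z : R) := z - sin z; pose df (z : R) := 1 - cos z.
suff : f 0 <= f x by rewrite /f sin0 subr0 subr_ge0.
apply: (@ge0_is_derive_le _ f df) => // z _.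
by rewrite subr_ge0 cos_le1.
Qed.

Lemma normr_sin_le (R : realType) (x : R) : `|sin x| <= `|x|.
Proof.
wlog x0 : x / 0 <= x.
  move=> H; have [/H//|/ltW] := leP 0 x.
  by rewrite -oppr_ge0 => /H; rewrite sinN !normrN.
rewrite (ger0_norm x0) ler_norml sin_le_id // andbT.
pose f (z : R) := z + sin z; pose df (z : R) := 1 + cos z.
suff : f 0 <= f x by rewrite /f sin0; lra.
apply: (@ge0_is_derive_le _ f df) => // z _.
by rewrite /df; have := cos_geN1 z; lra.
Qed.

Lemma cos_ge_quadratic (R : realType) (x : R) : 0 <= x -> 1 - x ^+ 2 / 2 <= cos x.
Proof.
move=> x0; pose f (z : R) := cos z + 2^-1 * z ^+ 2; pose df (z : R) := z - sin z.
suff : f 0 <= f x by rewrite /f cos0; lra.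
apply: (@ge0_is_derive_le _ f df) => // z /andP[z0 _].
  rewrite /f /df; apply: is_derive_eq; rewrite /GRing.scale /=; by field.
by rewrite subr_ge0 sin_le_id.
Qed.

Lemma sin_ge_half (R : realType) (x : R) : 0 <= x <= 1 -> x / 2 <= sin x.
Proof.
move=> /andP[x0 x1].
pose f (z : R) := sin z - 2^-1 * z; pose df (z : R) := cos z - 2^-1.
suff : f 0 <= f x by rewrite /f sin0; lra.
apply: (@ge0_is_derive_le _ f df) => // z /andP[z0 zx].
  rewrite /f /df; apply: is_derive_eq; rewrite /GRing.scale /=; by field.
have := cos_ge_quadratic z0; rewrite /df; nra.
Qed.

(** The quantity sin x - x cos x is - x ^ 2 times the derivative of sin x / x;
its own derivative x sin x lies between x ^ 2 / 2 and x ^ 2 on [0, 1]. *)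
Lemma sin_sub_xcos_le (R : realType) (x : R) :
  0 <= x -> sin x - x * cos x <= x ^+ 3 / 3.
Proof.
move=> x0; pose f (z : R) := 3^-1 * z ^+ 3 + z * cos z - sin z.
pose df (z : R) := z * (z - sin z).
suff : f 0 <= f x by rewrite /f sin0; lra.
apply: (@ge0_is_derive_le _ f df) => // z /andP[z0 _].
  rewrite /f /df; apply: is_derive_eq; rewrite /GRing.scale /=; by field.
by rewrite mulr_ge0 // subr_ge0 sin_le_id.
Qed.

Lemma sin_sub_xcos_ge (R : realType) (x : R) :
  0 <= x <= 1 -> x ^+ 3 / 6 <= sin x - x * cos x.
Proof.
move=> /andP[x0 x1]; pose f (z : R) := sin z - z * cos z - 6^-1 * z ^+ 3.
pose df (z : R) := z * (sin z - z / 2).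
suff : f 0 <= f x by rewrite /f sin0; lra.
apply: (@ge0_is_derive_le _ f df) => // z /andP[z0 zx].
  rewrite /f /df; apply: is_derive_eq; rewrite /GRing.scale /=; by field.
by rewrite mulr_ge0 // subr_ge0 sin_ge_half // z0 (le_trans zx).
Qed.

(** * The cardinal sine *)

Definition sinc (R : realType) (x : R) : R := if x == 0 then 1 else sin x / x.

Lemma sinc0 (R : realType) : sinc (0 : R) = 1.
Proof. by rewrite /sinc eqxx. Qed.

Lemma sincE (R : realType) (x : R) : x != 0 -> sinc x = sin x / x.
Proof. by rewrite /sinc => /negPf->. Qed.

Lemma mulr_sinc (R : realType) (x : R) : x * sinc x = sin x.
Proof.
have [->|x0] := eqVneq x 0; first by rewrite mul0r sin0.
by rewrite sincE // mulrC divfK.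
Qed.

Lemma sincN (R : realType) (x : R) : sinc (- x) = sinc x.
Proof.
have [->|x0] := eqVneq x 0; first by rewrite oppr0.
by rewrite !sincE ?oppr_eq0// sinN invrN mulrNN.
Qed.

Lemma normr_sinc_le1 (R : realType) (x : R) : `|sinc x| <= 1.
Proof.
have [->|x0] := eqVneq x 0; first by rewrite sinc0 normr1.
by rewrite sincE // normrM normfV ler_pdivrMr ?normr_gt0// mul1r normr_sin_le.
Qed.

Lemma sinc_ge_half (R : realType) (x : R) : 0 < x <= 1 -> 1 / 2 <= sinc x.
Proof.
move=> /andP[x0 x1]; rewrite sincE ?gt_eqF// ler_pdivlMr// mulrC mulrA mulr1.
by apply: sin_ge_half; rewrite ltW.
Qed.

Lemma is_derive_sinc (R : realType) (x : R) : 0 < x ->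
  is_derive x 1 (fun z : R => sin z / z) (- (sin x - x * cos x) / x ^+ 2).
Proof.
move=> x0; have xn0 : x != 0 by rewrite gt_eqF.
have dV : is_derive x 1 (fun y : R => y^-1) (- x ^- 2 *: (1 : R)).
  exact: (@is_deriveV _ id).
by apply: is_derive_eq; rewrite /GRing.scale /=; field.
Qed.

(** The derivative of sinc on ]0, 1] lies between - x / 3 and - x / 6, so that
- sinc x - x ^ 2 / 12 and sinc x + x ^ 2 / 6 are both nondecreasing. *)
Lemma sincB_bounds (R : realType) (x y : R) : 0 < y -> y <= x -> x <= 1 ->
  (x ^+ 2 - y ^+ 2) / 12 <= sinc y - sinc x <= (x ^+ 2 - y ^+ 2) / 6.
Proof.
move=> y0 yx x1.
have z0 z : y <= z <= x -> 0 < z by move=> /andP[yz _]; apply: lt_le_trans yz.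
rewrite !sincE ?gt_eqF ?(lt_le_trans y0 yx)//; apply/andP; split.
- pose f (z : R) := - (sin z / z) - 12^-1 * z ^+ 2.
  pose df (z : R) := (sin z - z * cos z - z ^+ 3 / 6) / z ^+ 2.
  suff : f y <= f x by rewrite /f; lra.
  apply: (@ge0_is_derive_le _ f df) => // z zyx.
    have zn0 : z != 0 by rewrite gt_eqF ?z0.
    have dS := is_derive_sinc (z0 _ zyx).
    rewrite /f /df; apply: is_derive_eq; rewrite /GRing.scale /=; by field.
  apply: divr_ge0; last exact: sqr_ge0.
  rewrite subr_ge0 sin_sub_xcos_ge// (ltW (z0 _ zyx)).
  by case/andP: zyx => _ /le_trans->.
- pose f (z : R) := sin z / z + 6^-1 * z ^+ 2.
  pose df (z : R) := (z ^+ 3 / 3 - (sin z - z * cos z)) / z ^+ 2.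
  suff : f y <= f x by rewrite /f; lra.
  apply: (@ge0_is_derive_le _ f df) => // z zyx.
    have zn0 : z != 0 by rewrite gt_eqF ?z0.
    have dS := is_derive_sinc (z0 _ zyx).
    rewrite /f /df; apply: is_derive_eq; rewrite /GRing.scale /=; by field.
  apply: divr_ge0; last exact: sqr_ge0.
  by rewrite subr_ge0 sin_sub_xcos_le// (ltW (z0 _ zyx)).
Qed.

(** Both increments are comparable to a difference of squares, and scaling by u
multiplies that difference by u ^ 2 <= 1; the ratio of the two constants in
[sincB_bounds] gives the factor 2. *)
Lemma normr_sincMB_le (R : realType) (u x y : R) :
  0 <= u <= 1 -> 0 < x <= 1 -> 0 < y <= 1 ->
  `|sinc (u * x) - sinc (u * y)| <= 2 * `|sinc x - sinc y|.
Proof.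
move=> /andP[u0 u1]; wlog yx : x y / y <= x.
  move=> H hx hy; have [yx|/ltW xy] := leP y x; first exact: H.
  by rewrite distrC (distrC (sinc x)); apply: H.
move=> /andP[x0 x1] /andP[y0 y1].
have [->|un0] := eqVneq u 0.
  by rewrite !mul0r subrr normr0 mulr_ge0.
have ugt0 : 0 < u by rewrite lt_def un0.
have uy_gt0 : 0 < u * y by rewrite mulr_gt0.
have uyx : u * y <= u * x by rewrite ler_pM2l.
have ux1 : u * x <= 1 by nra.
have /andP[lo _] := sincB_bounds y0 yx x1.
have /andP[ulo uhi] := sincB_bounds uy_gt0 uyx ux1.
have sq : 0 <= x ^+ 2 - y ^+ 2 by nra.
have u2 : 0 <= u ^+ 2 <= 1 by nra.
have {}ulo : 0 <= sinc (u * y) - sinc (u * x) by apply: le_trans ulo; nra.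
rewrite distrC (distrC (sinc x)) !ger0_norm //; last by nra.
have : u ^+ 2 * (x ^+ 2 - y ^+ 2) <= x ^+ 2 - y ^+ 2 by nra.
by move: uhi; rewrite !exprMn; lra.
Qed.

(** * Interpolation between integer frequencies *)

(** Multiplied by x ^ 2 this is an identity between products of sines, which
follows from the addition formulas alone. *)
Lemma sinc_interpolation (R : realType) (l s x : R) : x != 0 ->
  (l + s) * sinc ((l + s) * x) * sinc x =
  l * (1 - s) * (sinc (l * x) * sinc ((1 - s) * x)) +
  (l + 1) * s * (sinc ((l + 1) * x) * sinc (s * x)).
Proof.
move=> x0; apply: (mulIf (expf_neq0 2 x0)).
transitivity (sin ((l + s) * x) * sin x).
  rewrite -(mulr_sinc ((l + s) * x)) -(mulr_sinc x); ring.
transitivity (sin (l * x) * sin ((1 - s) * x) + sin ((l + 1) * x) * sin (s * x)).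
  rewrite mulrBl mul1r !mulrDl mul1r !sinD sinN cosN; ring.
rewrite -(mulr_sinc (l * x)) -(mulr_sinc ((1 - s) * x)).
rewrite -(mulr_sinc ((l + 1) * x)) -(mulr_sinc (s * x)); ring.
Qed.

Lemma normr_mulB_le (R : realType) (a b a' b' : R) :
  `|b| <= 1 -> `|a'| <= 1 -> `|a * b - a' * b'| <= `|a - a'| + `|b - b'|.
Proof.
move=> b1 a1; have -> : a * b - a' * b' = (a - a') * b + a' * (b - b') by ring.
apply: le_trans (ler_normD _ _) _; rewrite !normrM.
by rewrite lerD// ?ler_piMl ?ler_piMr.
Qed.

(** The increment of the interpolated value at l + s splits into those of the
two products, with convex weights, and that of the denominator sinc x, which
is at least 1/2. *)
Lemma normr_sinc_step (R : realType) (l s x y : R) :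
  0 <= l -> 0 <= s <= 1 -> 0 < x <= 1 -> 0 < y <= 1 ->
  `|sinc ((l + s) * x) - sinc ((l + s) * y)| <=
  2 * `|sinc (l * x) - sinc (l * y)| +
  2 * `|sinc ((l + 1) * x) - sinc ((l + 1) * y)| + 10 * `|sinc x - sinc y|.
Proof.
move=> l0 s01 hx hy; have /andP[s0 s1] := s01.
have s01' : 0 <= 1 - s <= 1 by lra.
have [t0|tn0] := eqVneq (l + s) 0.
  by rewrite t0 !mul0r subrr normr0 !addr_ge0 ?mulr_ge0.
have t_gt0 : 0 < l + s by rewrite lt_def tn0 addr_ge0.
have x0 : x != 0 by case/andP: hx => /gt_eqF->.
have y0 : y != 0 by case/andP: hy => /gt_eqF->.
have Ex := sinc_interpolation l s x0; have Ey := sinc_interpolation l s y0.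
have qx := sinc_ge_half hx; have qy := sinc_ge_half hy.
set P := sinc (l * x) * sinc ((1 - s) * x) in Ex.
set Q := sinc ((l + 1) * x) * sinc (s * x) in Ex.
set P' := sinc (l * y) * sinc ((1 - s) * y) in Ey.
set Q' := sinc ((l + 1) * y) * sinc (s * y) in Ey.
have dP : `|P - P'| <= `|sinc (l * x) - sinc (l * y)| + 2 * `|sinc x - sinc y|.
  apply: le_trans (normr_mulB_le _ _ _ _) _; rewrite ?normr_sinc_le1//.
  by rewrite lerD2l normr_sincMB_le.
have dQ : `|Q - Q'| <= `|sinc ((l + 1) * x) - sinc ((l + 1) * y)|
                       + 2 * `|sinc x - sinc y|.
  apply: le_trans (normr_mulB_le _ _ _ _) _; rewrite ?normr_sinc_le1//.
  by rewrite lerD2l normr_sincMB_le.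
set F := sinc ((l + s) * x) in Ex *; set F' := sinc ((l + s) * y) in Ey *.
have F'1 : `|F'| <= 1 by exact: normr_sinc_le1.
set q := sinc x in Ex qx dP dQ *; set q' := sinc y in Ey qy dP dQ *.
(* The difference of the interpolation formulas at x and y. *)
have key : (l + s) * ((F - F') * q) =
    l * (1 - s) * (P - P') + (l + 1) * s * (Q - Q') - (l + s) * (F' * (q - q')).
  by lra.
have : (l + s) * (`|F - F'| * q) <=
    (l + s) * (`|P - P'| + `|Q - Q'| + `|q - q'|).
  rewrite -{1}(ger0_norm (ltW t_gt0)) -{1}(@ger0_norm _ q); last by lra.
  rewrite -!normrM key.
  apply: le_trans (ler_normB _ _) _; rewrite [leRHS]mulrDr lerD//; last first.
    by rewrite !normrM (gtr0_norm t_gt0) ler_pM2l// ler_piMl.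
  apply: le_trans (ler_normD _ _) _; rewrite [leRHS]mulrDr !normrM lerD//.
    rewrite ler_wpM2r// !ger0_norm//; nra.
  rewrite ler_wpM2r// !ger0_norm//; nra.
rewrite ler_pM2l// => H.
have half : `|F - F'| * (1 / 2) <= `|F - F'| * q by rewrite ler_wpM2l.
lra.
Qed.

(** * Variation along the sequence of scales *)

Lemma nneseries_le_fin_iff (R : realType) (m : nat) (u : nat -> R) (C : R) :
  (forall k, 0 <= u k) ->
  (\sum_(m <= k <oo) (u k)%:E <= C%:E)%E <->
  (forall n, \sum_(m <= k < n) u k <= C).
Proof.
move=> u0; split=> [H n|H].
  rewrite -lee_fin -sumEFin; apply: le_trans H.
  by apply: nneseries_lim_ge => k _ _; rewrite lee_fin.
apply: lime_le; first by apply: is_cvg_nneseries => k _ _; rewrite lee_fin.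
by apply: nearW => n; rewrite sumEFin lee_fin.
Qed.

Lemma phihat_lineE (R : realType) (eps t : R) :
  0 < eps -> phihat_line eps t = sinc (t * eps).
Proof.
by move=> e0; rewrite /phihat_line /sinc mulf_eq0 (gt_eqF e0) orbF (mulrC eps).
Qed.

Lemma phihat_circleE (R : realType) (eps : R) (l : int) :
  phihat_circle eps l = phihat_line eps l%:~R.
Proof. by rewrite /phihat_circle /phihat_line intr_eq0 (mulrC eps). Qed.

Theorem theorem5p5 (R : realType) (eps : nat -> R)
  (eps_gt0 : forall k : nat, (1 <= k)%N -> 0 < eps k)
  (eps_cvg0 : eps n @[n --> \oo] --> 0) :
  (exists C : R,
     (ereal_sup (range (fun l : int =>
        \sum_(1 <= k <oo)
          `|phihat_circle (eps k.+1) l - phihat_circle (eps k) l|%:E))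
      <= C%:E)%E)
  <->
  (exists K : R,
     (ereal_sup (range (fun t : R =>
        \sum_(1 <= k <oo)
          `|phihat_line (eps k.+1) t - phihat_line (eps k) t|%:E))
      <= K%:E)%E).
Proof.
split=> [[C /ereal_supP HC]|[K /ereal_supP HK]]; last first.
  exists K; apply/ereal_supP => _ [l _ <-]; apply: HK; exists l%:~R => //.
  by congr (limn _); apply/funext => n; apply: eq_bigr => k _;
     rewrite !phihat_circleE.
pose d (t : R) k := `|phihat_line (eps k.+1) t - phihat_line (eps k) t|.
have d_ge0 t k : 0 <= d t k by exact: normr_ge0.
have d_le2 t k : (1 <= k)%N -> d t k <= 2.
  move=> k1; apply: le_trans (ler_normB _ _) _.
  have := normr_sinc_le1 (t * eps k.+1); have := normr_sinc_le1 (t * eps k).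
  by rewrite !phihat_lineE ?eps_gt0//; lra.
have dC (l n : nat) : \sum_(1 <= k < n) d l%:R k <= C.
  have /(nneseries_le_fin_iff 1 _ (d_ge0 _)) -> // :
    (\sum_(1 <= k <oo) (d l%:R k)%:E <= C%:E)%E.
  apply: HC; exists (Posz l) => //.
  by congr (limn _); apply/funext => n'; apply: eq_bigr => k _;
     rewrite !phihat_circleE.
have [N _ epsN] : \forall k \near \oo, `|eps k| < 1.
  by apply: cvgr0_norm_lt; [exact: eps_cvg0|exact: ltr01].
(* c k flags the steps that start from a possibly large scale. *)
pose c k : R := (k < N)%:R.
have sum_c n : \sum_(1 <= k < n) c k <= N%:R.
  rewrite -natr_sum ler_nat.
  suff : (\sum_(1 <= k < n) (k < N) <= minn n N)%N.
    by move=> /leq_trans -> //; rewrite geq_minr.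
  elim: n => [|[|n] IH]; [by rewrite big_geq|by rewrite big_geq|].
  rewrite big_nat_recr//=.
  by move: IH; lia.
have dt (t : R) k : 0 <= t -> (1 <= k)%N ->
    d t k <= 2 * c k + 2 * d (Num.truncn t)%:R k + 2 * d (Num.truncn t).+1%:R k
             + 10 * d 1%:R k.
  move=> t0 k1; rewrite /c; case: ltnP => kN /=.
    have := d_le2 t k k1; have := d_ge0 (Num.truncn t)%:R k.
    have := d_ge0 (Num.truncn t).+1%:R k; have := d_ge0 1%:R k; lra.
  have /andP[tl tr] := truncn_itv t0; set l := Num.truncn t in tl tr *.
  have e01 j : (k <= j)%N -> 0 < eps j <= 1.
    move=> kj; have j1 := leq_trans k1 kj; rewrite eps_gt0 //=.
    by apply: le_trans (ler_norm _) (ltW (epsN _ (leq_trans kN kj))).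
  have s01 : 0 <= t - l%:R <= 1.
    by move: tr; rewrite -natr1; lra.
  have := normr_sinc_step (ler0n R l) s01 (e01 _ (leqnSn k)) (e01 _ (leqnn k)).
  rewrite /d !phihat_lineE ?eps_gt0// (addrC l%:R) subrK natr1 !mul1r; lra.
(* 14 = 2 + 2 + 10, the coefficients of the three integer frequencies. *)
exists (2 * N%:R + 14 * C); apply/ereal_supP => _ [t _ <-].
apply/(nneseries_le_fin_iff 1 _ (d_ge0 t)) => n.
wlog t0 : t / 0 <= t.
  move=> H; have [/H//|/ltW] := leP 0 t; rewrite -oppr_ge0 => /H.
  congr (_ <= _); apply: eq_big_nat => k /andP[k1 _].
  by rewrite /d !phihat_lineE ?eps_gt0// !mulNr !sincN.
apply: (@le_trans _ _ (\sum_(1 <= k < n) (2 * c k + 2 * d (Num.truncn t)%:R k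
    + 2 * d (Num.truncn t).+1%:R k + 10 * d 1%:R k))).
  by apply: ler_sum_nat => k /andP[k1 _]; exact: dt.
rewrite !big_split /= -!mulr_sumr.
have := sum_c n; have := dC (Num.truncn t) n.
have := dC (Num.truncn t).+1 n; have := dC 1 n; lra.
Qed.
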